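(* Let $G$ be a graph of order $n$ realizing the set $S_{\{i,j\}_{n}^{2}}$, where $0<i<j\leqslant n$ and $2\notin\{i,j\}$. If $i>1$, then $j>n-3$.
   Context: For a simple graph $G$, its Laplacian spectrum is the multiset of eigenvalues of $L(G)=D-A$. For integers $0<i<j\leqslant n$ and $m\in\{1,\dots,n\}\setminus\{i,j\}$, $S_{\{i,j\}_{n}^{m}}$ denotes the multiset $\{0,1,\ldots,m-1,m,m,m+1,\ldots,n\}\setminus\{i,j\}$. A graph realizes a multiset $S$ if it is simple, connected, and its Laplacian spectrum (with multiplicities) equals $S$. *)

(* Defs.v *)
From HB Require Import structures.
From mathcomp Require Import all_boot all_order all_algebra all_field.
Set Implicit Arguments.
Unset Strict Implicit.
Unset Printing Implicit Defensive.
Import GRing.Theory.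
Local Open Scope ring_scope.

Record sgraph : Type := SGraph {
  vertex :> finType;
  adj : rel vertex;
  adj_sym : symmetric adj;
  adj_irr : irreflexive adj
}.

Definition degree (G : sgraph) (x : G) : nat := #|[set y | adj x y]|.

Definition connected_graph (G : sgraph) : Prop :=
  forall x y : G, connect (@adj G) x y.

(* Rows and columns are indexed by the library's enumeration of the vertices;
   another enumeration would conjugate these matrices by a permutation. *)
Definition adjacency_mx (G : sgraph) : 'M[algC]_#|G| :=
  \matrix_(u, v) (adj (enum_val u) (enum_val v))%:R.

Definition degree_mx (G : sgraph) : 'M[algC]_#|G| :=
  diag_mx (\row_u (degree (enum_val u))%:R).

Definition laplacian_mx (G : sgraph) : 'M[algC]_#|G| :=
  degree_mx G - adjacency_mx G.

(* Multisets are sequences compared with perm_eq. The eigenvalues of A, with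
   multiplicity, are the roots of its (monic) characteristic polynomial. *)
Definition spectrum (k : nat) (A : 'M[algC]_k) : seq algC :=
  sval (closed_field_poly_normal (char_poly A)).

Lemma spectrumE (k : nat) (A : 'M[algC]_k) :
  char_poly A = \prod_(z <- spectrum A) ('X - z%:P).
Proof.
rewrite /spectrum; case: closed_field_poly_normal => s /= {1}->.
by rewrite (monicP (char_poly_monic A)) scale1r.
Qed.

Definition laplacian_spectrum (G : sgraph) : seq algC :=
  spectrum (laplacian_mx G).

(* {0, ..., m-1, m, m, m+1, ..., n} minus {i, j}, for 0 < i < j <= n and
   m in {1, ..., n} minus {i, j}. *)
Definition Sset (n m i j : nat) : seq nat :=
  [seq k <- iota 0 m.+1 ++ iota m (n - m).+1 | k \notin [:: i; j]].

Definition realizes (G : sgraph) (s : seq nat) : Prop :=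
  connected_graph G /\
  perm_eq (laplacian_spectrum G) [seq k%:R | k <- s].

(* Main.v *)
(* If [j <= n - 3], the spectrum contains 1, 2, 2, n-2, n-1 and n.  When a graph
   on [s] vertices has the Laplacian eigenvalues [s] and 1, it is a join, and 1
   forces one side of the join to be a single vertex.  Deleting this dominating
   vertex and complementing maps each other nonzero eigenvalue [l] to [s - l],
   and the eigenvalues above make this step possible four times in a row.  The
   two eigenvectors for 2 and the one for [n - 2] then survive on [n - 4]
   vertices as a graph that is disconnected together with its complement. *)
Require Import Defs.
From mathcomp Require Import all_boot all_order all_algebra all_field.
From mathcomp Require Import ring zify.
Set Implicit Arguments.
Unset Strict Implicit.
Unset Printing Implicit Defensive.
Import Order.TTheory GRing.Theory Num.Theory.

(** * Laplacian eigenvectors on a subset of the vertices *)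

Section InducedLaplacian.
Local Open Scope ring_scope.
Variables (C : numClosedFieldType) (T : finType).
Implicit Types (e : rel T) (S A : {set T}) (x y : T -> C) (l : C) (u v w d : T).

Definition lap e S x u : C := \sum_(v in S) (e u v)%:R * (x u - x v).

(** This has loops when [e] is irreflexive, which is harmless: the diagonal terms of [lap]
    vanish. *)
Definition compl_rel e : rel T := fun u v => ~~ e u v.

(** The zero-sum condition excludes constant functions, so that for symmetric [e] the eigenvalue 0
    means disconnected, and complementing acts on eigenvalues. *)
Definition eigv e S l x : Prop :=
  [/\ \sum_(u in S) x u = 0, exists2 u, u \in S & x u != 0 &
      {in S, forall u, lap e S x u = l * x u}].

Lemma compl_rel_sym e : symmetric e -> symmetric (compl_rel e).
Proof. by move=> sym u v; rewrite /compl_rel sym. Qed.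

Lemma lap_compl e S x u :
  lap (compl_rel e) S x u = #|S|%:R * x u - \sum_(v in S) x v - lap e S x u.
Proof.
rewrite mulr_natl -sumr_const -!sumrB; apply: eq_bigr => v _.
by rewrite /compl_rel; case: (e u v) => /=; ring.
Qed.

Lemma sum_lap e S x : symmetric e -> \sum_(u in S) lap e S x u = 0.
Proof.
move=> sym; pose s := \sum_(u in S) \sum_(v in S) (e u v)%:R * x u.
rewrite /lap; transitivity (s - s); last exact: subrr.
rewrite [X in _ - X]exchange_big -sumrB; apply: eq_bigr => u _ /=.
by rewrite -sumrB; apply: eq_bigr => v _; rewrite (sym v u) mulrBr.
Qed.

(** Symmetrizing in [u] and [v] gives the Dirichlet form; the factor 2 is there because each edge is
    counted in both directions. *)
Lemma lap_form e S x : symmetric e ->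
  2 * (\sum_(u in S) (x u)^* * lap e S x u) =
  \sum_(u in S) \sum_(v in S) (e u v)%:R * `|x u - x v| ^+ 2.
Proof.
move=> sym; set s := \sum_(u in S) (x u)^* * lap e S x u.
have s1 : s = \sum_(u in S) \sum_(v in S) (e u v)%:R * ((x u)^* * (x u - x v)).
  by apply: eq_bigr => u _; rewrite /lap mulr_sumr; apply: eq_bigr => v _; ring.
have s2 : s = \sum_(u in S) \sum_(v in S) (e u v)%:R * ((x v)^* * (x v - x u)).
  rewrite s1 exchange_big; apply: eq_bigr => u _; apply: eq_bigr => v _.
  by rewrite sym.
rewrite mulr2n mulrDl !mul1r {1}s1 s2 -big_split; apply: eq_bigr => u _ /=.
rewrite -big_split; apply: eq_bigr => v _ /=.
by rewrite normCK rmorphB /=; ring.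
Qed.

Lemma lap_eigen_ge0 e S l x : symmetric e ->
  {in S, forall u, lap e S x u = l * x u} ->
  (exists2 u, u \in S & x u != 0) -> 0 <= l.
Proof.
move=> sym eig [u0 u0S xu0].
have q : 2 * (l * \sum_(u in S) `|x u| ^+ 2) =
         \sum_(u in S) \sum_(v in S) (e u v)%:R * `|x u - x v| ^+ 2.
  rewrite -lap_form // [l * _]mulr_sumr; congr (_ * _); apply: eq_bigr => u uS.
  by rewrite eig // normCK; ring.
have pos : 0 < \sum_(u in S) `|x u| ^+ 2.
  rewrite (bigD1 u0) //= ltr_pwDl ?exprn_gt0 ?normr_gt0 //.
  by apply: sumr_ge0 => u _; rewrite exprn_ge0.
have : 0 <= 2 * (l * \sum_(u in S) `|x u| ^+ 2).
  rewrite q; apply: sumr_ge0 => u _; apply: sumr_ge0 => v _.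
  by rewrite mulr_ge0 ?exprn_ge0.
by rewrite pmulr_rge0 // pmulr_lge0.
Qed.

(** The quadratic form vanishes, and so does each of its nonnegative terms. *)
Lemma lap_eq0_edge e S x : symmetric e ->
  {in S, forall u, lap e S x u = 0} ->
  {in S &, forall u v, e u v -> x u = x v}.
Proof.
move=> sym ker u v uS vS euv.
have ge0 a b : 0 <= (e a b)%:R * `|x a - x b| ^+ 2 by rewrite mulr_ge0 ?exprn_ge0.
have /eqP := lap_form S x sym.
rewrite big1 ?mulr0 => [|a aS]; last by rewrite ker ?mulr0.
rewrite eq_sym psumr_eq0 => [/allP/(_ u)|a _]; last exact: sumr_ge0.
rewrite mem_index_enum uS /= => /(_ isT).
rewrite psumr_eq0 // => /allP/(_ v); rewrite mem_index_enum vS /= => /(_ isT).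
by rewrite euv mul1r expf_eq0 /= normr_eq0 subr_eq0 => /eqP.
Qed.

(** Complementing turns the eigenvalue into 0, so [x] is constant along non-edges. *)
Lemma eigv_card_edge e S x : symmetric e -> eigv e S #|S|%:R x ->
  {in S &, forall u v, x u != x v -> e u v}.
Proof.
move=> sym [sum0 _ eig] u v uS vS; apply: contraNT => neuv; apply/eqP.
apply: (lap_eq0_edge (compl_rel_sym sym) _ uS vS neuv) => a aS.
by rewrite lap_compl eig // sum0 subr0 subrr.
Qed.

Lemma eigv_nonconst e S l x u : eigv e S l x -> u \in S ->
  exists2 v, v \in S & x v != x u.
Proof.
move=> [sum0 [u0 u0S xu0] _] uS; apply/exists_inP; apply: contraNT xu0.
rewrite negb_exists_in => /forall_inP con.
have cst v : v \in S -> x v = x u by move=> /con; rewrite negbK => /eqP.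
have /eqP := sum0; rewrite (eq_bigr _ cst) sumr_const -mulr_natl mulf_eq0.
by rewrite pnatr_eq0 (cardD1 u0) u0S cst //=.
Qed.

(* [lap e S x = 0] says that [x] is constant on the components of [e], the
   other eigenvalue that the complement of [e] is disconnected. *)
Lemma eigv_0_card_absurd e S x y : symmetric e ->
  eigv e S 0 x -> eigv e S #|S|%:R y -> False.
Proof.
move=> sym ex ey; have [_ [a aS _] xeig] := ex.
have xe : {in S &, forall u v, e u v -> x u = x v}.
  by apply: lap_eq0_edge => // u uS; rewrite xeig // mul0r.
have xy u v : u \in S -> v \in S -> y u != y v -> x u = x v.
  by move=> uS vS yuv; apply: xe => //; apply: (eigv_card_edge sym ey).
have [b bS yb] := eigv_nonconst ey aS.
have [c cS /eqP[]] := eigv_nonconst ex aS.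
(* If [y c] and [y a] agree, [y b] differs from both, so [x] agrees at [a], [b] and [c]. *)
have [yca|] := eqVneq (y c) (y a); last exact: xy.
by transitivity (x b); apply: xy => //; rewrite yca eq_sym.
Qed.

Definition dominating e S w := {in S, forall u, u != w -> e w u}.

(* In a join [S = A + B] an eigenvector [y] for an eigenvalue other than [#|S|]
   sums to zero on each side, so it is an eigenvector of [A] for [l - #|B|]. *)
Lemma join_eigenvalue_ge e S A l y : symmetric e -> A \subset S ->
  {in A & S :\: A, forall u v, e u v} -> l != #|S|%:R ->
  \sum_(u in S) y u = 0 -> {in S, forall u, lap e S y u = l * y u} ->
  (exists2 u, u \in A & y u != 0) -> #|S :\: A|%:R <= l.
Proof.
move=> sym sAS join lS sum0 eig nz.
have lapA u : u \in A -> lap e S y u =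
    lap e A y u + (#|S :\: A|%:R * y u - \sum_(v in S :\: A) y v).
  move=> uA; rewrite /lap (big_setID A) /= (setIidPr sAS); congr (_ + _).
  rewrite mulr_natl -sumr_const -sumrB; apply: eq_bigr => v vB.
  by rewrite join // mul1r.
have sumB : \sum_(v in S :\: A) y v = - \sum_(v in A) y v.
  apply/eqP; rewrite -addr_eq0 addrC -[X in _ == X]sum0.
  by rewrite [X in _ == X](big_setID A) /= (setIidPr sAS).
(* Summing the eigenvalue equation over [A] cancels the part internal to [A] and leaves
   [#|S|%:R - l] times this sum equal to 0. *)
have sumA : \sum_(v in A) y v = 0.
  have : \sum_(u in A) (lap e S y u - l * y u) = 0.
    by apply: big1 => u uA; rewrite eig ?subrr // (subsetP sAS).
  under eq_bigr => u uA do rewrite lapA // -addrA.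
  rewrite big_split sum_lap //= add0r !sumrB sumr_const -!mulr_sumr sumB.
  rewrite -mulr_natl => eq0.
  have : (#|S|%:R - l) * \sum_(v in A) y v = 0.
    by rewrite -(cardsID A S) (setIidPr sAS) natrD -[RHS]eq0; ring.
  by move/eqP; rewrite mulf_eq0 subr_eq0 eq_sym (negPf lS) => /eqP.
rewrite -subr_ge0; apply: (lap_eigen_ge0 sym) nz => u uA.
have := eig u (subsetP sAS u uA); rewrite lapA // sumB sumA oppr0 subr0 => eq1.
by rewrite mulrBl -eq1 addrK.
Qed.

(** The level set [A] of [x] through a vertex where [y] is nonzero is joined to [S :\: A]. The
    eigenvalue 1 bounds the size of [S :\: A] by 1, and its only vertex dominates. *)
Lemma ex_dominating e S n x y : symmetric e -> #|S| = n -> (1 < n)%N ->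
  eigv e S n%:R x -> eigv e S 1 y -> exists2 w, w \in S & dominating e S w.
Proof.
move=> sym <- S1 ex [sum0 [u0 u0S yu0] eig].
have [_ [a aS _] _] := ex; have [b bS xb] := eigv_nonconst ex aS.
have card_ne : 1 != #|S|%:R :> C by rewrite eq_sym pnatr_eq1 neq_ltn S1 orbT.
pose A := [set u in S | x u == x u0].
have sAS : A \subset S by apply/subsetP => u; rewrite inE => /andP[].
have u0A : u0 \in A by rewrite inE u0S eqxx.
have join : {in A & S :\: A, forall u v, e u v}.
  move=> u v; rewrite !inE => /andP[uS /eqP xu] /andP[+ vS]; rewrite vS /= => xv.
  by apply: (eigv_card_edge sym ex) => //; rewrite xu eq_sym.
have := join_eigenvalue_ge sym sAS join card_ne sum0 eig.
move=> /(_ (ex_intro2 _ _ u0 u0A yu0)); rewrite (ler_nat C _ 1) => cardB.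
have [w wS xw] := eigv_nonconst ex u0S.
have wB : w \in S :\: A by rewrite !inE wS (negPf xw).
have /cards1P[w' Bw'] : #|S :\: A| == 1%N.
  by rewrite eqn_leq cardB card_gt0; apply/set0Pn; exists w.
move: wB; rewrite Bw' inE => /eqP ww'; rewrite -{}ww' in Bw'.
exists w => // u uS uw; rewrite sym; apply: join; last by rewrite Bw' inE.
by apply: contraNT uw => uA; rewrite -in_set1 -Bw' inE uA.
Qed.

(** As [x] sums to 0, the Laplacian at a dominating vertex multiplies by [#|S|]. *)
Lemma eigv_dominating0 e S l x w : w \in S -> dominating e S w ->
  eigv e S l x -> l != #|S|%:R -> x w = 0.
Proof.
move=> wS dom [sum0 _ eig] lS.
have : lap e S x w = #|S|%:R * x w.
  rewrite -[RHS]subr0 -sum0 mulr_natl -sumr_const -sumrB.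
  apply: eq_bigr => v vS; have [->|vw] := eqVneq v w.
    by rewrite subrr mulr0.
  by rewrite dom // mul1r.
rewrite eig // => /eqP; rewrite -subr_eq0 -mulrBl mulf_eq0 subr_eq0 (negPf lS).
by move=> /eqP.
Qed.

(** Deleting [w], where [x] vanishes, lowers [l] by 1; complementing on [#|S| - 1] vertices then
    gives [#|S| - 1 - (l - 1)]. *)
Lemma eigv_compl_remove e S l x w : symmetric e -> w \in S -> dominating e S w ->
  eigv e S l x -> x w = 0 -> eigv (compl_rel e) (S :\ w) (#|S|%:R - l) x.
Proof.
move=> sym wS dom [sum0 [u0 u0S xu0] eig] xw.
have sum1 : \sum_(u in S :\ w) x u = 0.
  by rewrite -[RHS]sum0 [RHS](big_setD1 w) //= xw add0r.
split=> [//||u].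
  exists u0 => //; rewrite !inE u0S andbT.
  by apply: contraNneq xu0 => ->; rewrite xw.
rewrite !inE => /andP[uw uS]; rewrite lap_compl sum1 subr0.
rewrite (cardsD1 w S) wS natrD mulrBl -eig // [X in _ = _ - X]/lap.
rewrite [X in _ = _ - X](big_setD1 w) //= xw subr0 sym dom // -/(lap e _ x u).
by rewrite mul1r; ring.
Qed.

Lemma eigv_dominating_step e S (l k : nat) x w :
  symmetric e -> w \in S -> dominating e S w -> (0 < k)%N -> #|S| = (l + k)%N ->
  eigv e S l%:R x -> eigv (compl_rel e) (S :\ w) k%:R x.
Proof.
move=> sym wS dom k0 cS ex.
have -> : k%:R = #|S|%:R - l%:R :> C by rewrite cS natrD addrC addKr.
apply: (eigv_compl_remove sym wS dom ex); apply: (eigv_dominating0 wS dom ex).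
by rewrite cS eqr_nat -[l in l == _]addn0 eqn_add2l ltn_eqF.
Qed.

(* With [N = #|T| = n + 4], the eigenvalues evolve as
     N, 1, 2, N-1, N-2  ->  N-1, N-2, 1, 2  ->  1, N-2, N-3  ->  N-3, 1
   on sets of size N, N-1, N-2, N-3.  The last deletion keeps the eigenvalue
   N-3, which comes from 2, thanks to an eigenvector vanishing at the deleted
   vertex. *)
Lemma eigenvalues_absurd e n (xn x1 xn1 xn2 : T -> C) :
  symmetric e -> #|T| = n.+4 -> (0 < n)%N ->
  eigv e setT n.+4%:R xn -> eigv e setT 1%:R x1 ->
  eigv e setT n.+3%:R xn1 -> eigv e setT n.+2%:R xn2 ->
  (forall w, exists2 x2, eigv e setT 2%:R x2 & x2 w = 0) -> False.
Proof.
move=> sym cT n0 exn ex1 exn1 exn2 ex2.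
have cardD S m w : w \in S -> #|S| = m.+1 -> #|S :\ w| = m.
  by move=> wS; rewrite (cardsD1 w) wS => -[].
have c0 : #|[set: T]| = n.+4 by rewrite cardsT.
have [w1 w1S dom1] := ex_dominating sym c0 isT exn ex1.
have c1 := cardD _ _ _ w1S c0; have sym1 := compl_rel_sym sym.
have st1 := eigv_dominating_step sym w1S dom1.
have y1 := st1 1%N n.+3 _ isT c0 ex1.
have yn1 := st1 n.+3 1%N _ isT (etrans c0 (esym (addn1 _))) exn1.
have yn2 := st1 n.+2 2%N _ isT (etrans c0 (esym (addn2 _))) exn2.
(* Left open for any eigenvector for 2, as the final choice depends on [w4]. *)
have {}st1 x := st1 2%N n.+2 x isT c0.
set e1 := compl_rel e in sym1 *; set S1 := setT :\ w1 in c1 *.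
have [w2 w2S dom2] := ex_dominating sym1 c1 isT y1 yn1.
have c2 := cardD _ _ _ w2S c1; have sym2 := compl_rel_sym sym1.
have st2 := eigv_dominating_step sym1 w2S dom2.
have zn1 := st2 1%N n.+2 _ isT c1 yn1.
have zn2 := st2 2%N n.+1 _ isT c1 yn2.
have {}st2 x := st2 n.+2 1%N x isT (etrans c1 (esym (addn1 _))).
set e2 := compl_rel e1 in sym2 *; set S2 := S1 :\ w2 in c2 *.
have [x2 ex _] := ex2 w1; have z2 := st2 _ (st1 _ ex).
have [w3 w3S dom3] := ex_dominating sym2 c2 isT zn1 z2.
have c3 := cardD _ _ _ w3S c2; have sym3 := compl_rel_sym sym2.
have st3 := eigv_dominating_step sym2 w3S dom3.
have tn2 := st3 n.+1 1%N _ isT (etrans c2 (esym (addn1 _))) zn2.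
have {}st3 x := st3 1%N n.+1 x isT c2.
set e3 := compl_rel e2 in sym3 *; set S3 := S2 :\ w3 in c3 *.
have [w4 w4S dom4] := ex_dominating sym3 c3 n0 (st3 _ z2) tn2.
have c4 := cardD _ _ _ w4S c3; have sym4 := compl_rel_sym sym3.
have un2 := eigv_dominating_step (l := 1) (k := n) sym3 w4S dom4 n0 c3 tn2.
(* The eigenvalue on [S3] is [n.+1], its number of vertices, so vanishing at [w4] is not automatic
   and has to be chosen. *)
have [x2' ex' x2'w] := ex2 w4; have t2 := st3 _ (st2 _ (st1 _ ex')).
have := eigv_compl_remove sym3 w4S dom4 t2 x2'w; rewrite c3 subrr => u2.
by apply: (eigv_0_card_absurd sym4 u2); rewrite c4; apply: un2.
Qed.

End InducedLaplacian.

(** * From the spectrum of the matrix to eigenvectors *)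

Section Spectrum.
Local Open Scope ring_scope.


Lemma char_poly_conj (R : comUnitRingType) k (P B : 'M[R]_k) : P \in unitmx ->
  char_poly (invmx P *m B *m P) = char_poly B.
Proof.
move=> uP; have PVP : map_mx (@polyC R) (invmx P) *m map_mx (@polyC R) P = 1%:M.
  by rewrite -map_mxM mulVmx // map_mx1.
rewrite /char_poly.
have -> : char_poly_mx (invmx P *m B *m P) =
    map_mx (@polyC R) (invmx P) *m char_poly_mx B *m map_mx (@polyC R) P.
  rewrite /char_poly_mx mulmxBr mulmxBl -!map_mxM; congr (_ - _).
  by rewrite mul_mx_scalar -scalemxAl PVP scalemx1.
by rewrite !det_mulmx mulrAC -det_mulmx PVP det1 mul1r.
Qed.

(** This turns the multiplicity of a root into a number of rows of [spectralmx A], which are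
    independent eigenvectors. *)
Lemma perm_spectrum_diag k (A : 'M[algC]_k) : A \is normalmx ->
  perm_eq (spectrum A) [seq spectral_diag A 0 i | i <- enum 'I_k].
Proof.
move=> /orthomx_spectralP eA; apply: prod_XsubC_eq; rewrite -spectrumE.
rewrite {1}eA char_poly_conj ?spectral_unit // char_poly_trig ?diag_mx_is_trig //.
rewrite big_map big_enum; apply: eq_bigr => i _ /=.
by rewrite mxE eqxx mulr1n.
Qed.

Lemma row_spectralmx k (A : 'M[algC]_k) i : A \is normalmx ->
  row i (spectralmx A) *m A = spectral_diag A 0 i *: row i (spectralmx A).
Proof.
move=> /orthomx_spectralP eA.
rewrite [X in _ *m X = _]eA -row_mul !mulmxA mulmxV ?spectral_unit //.
by rewrite mul1mx mul_diag_mx; apply/rowP => j; rewrite !mxE.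
Qed.

Lemma row_spectralmx_comb_neq0 k (A : 'M[algC]_k) i j a b : i != j ->
  (a != 0) || (b != 0) ->
  a *: row i (spectralmx A) + b *: row j (spectralmx A) != 0.
Proof.
move=> ij; apply: contraTneq; rewrite !rowE !scalemxAl -mulmxDl.
move=> /(congr1 (mulmx^~ (invmx (spectralmx A)))).
rewrite mulmxK ?spectral_unit // mul0mx => /rowP e0.
have := e0 i; have := e0 j; rewrite !mxE !eqxx (negPf ij) eq_sym (negPf ij) /=.
by rewrite !mulr0 !mulr1 addr0 add0r => -> ->; rewrite eqxx.
Qed.

Variable G : sgraph.

Lemma laplacian_mxE u v : laplacian_mx G u v =
  (degree (enum_val u))%:R *+ (u == v) - (adj (enum_val u) (enum_val v))%:R.
Proof. by rewrite !mxE. Qed.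

Lemma laplacian_mx_normal : laplacian_mx G \is normalmx.
Proof.
suff herm : map_mx Num.conj (laplacian_mx G)^T = laplacian_mx G.
  by apply/normalmxP; rewrite herm.
apply/matrixP => u v; rewrite 2!mxE !laplacian_mxE rmorphB rmorphMn /= !conjC_nat.
by rewrite adj_sym eq_sym; case: eqP => [->|].
Qed.

Lemma row_laplacian_mx (v : 'rV_#|G|) (x := fun u => v 0 (enum_rank u)) u :
  (v *m laplacian_mx G) 0 (enum_rank u) = lap (@adj G) setT x u.
Proof.
rewrite mxE; under eq_bigr => w _ do rewrite laplacian_mxE mulrBr.
rewrite sumrB (bigD1 (enum_rank u)) //= eqxx mulr1n big1 ?addr0; last first.
  by move=> w /negPf->; rewrite mulr0n mulr0.
rewrite enum_rankK /lap; under [RHS]eq_bigr => w _ do rewrite mulrBr.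
rewrite sumrB; congr (_ - _).
  rewrite -mulr_suml mulrC /degree -sum1_card natr_sum big_mkcond /=; congr (_ * _).
  rewrite [RHS]big_mkcond; apply: eq_bigr => w _.
  by rewrite !inE; case: (adj u w).
rewrite (reindex (@enum_rank G)) /=; last first.
  by exists (@enum_val G G) => w _; rewrite ?enum_rankK ?enum_valK.
rewrite [RHS]big_mkcond; apply: eq_bigr => w _.
by rewrite inE enum_rankK adj_sym mulrC.
Qed.

(** The entries of the image sum to 0, so [l != 0] forces those of [v] to do so. *)
Lemma row_laplacian_eigv (l : algC) (v : 'rV_#|G|) : l != 0 -> v != 0 ->
  v *m laplacian_mx G = l *: v ->
  eigv (@adj G) setT l (fun x => v 0 (enum_rank x)).
Proof.
move=> l0 v0 eig; pose x u := v 0 (enum_rank u).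
have xeig u : lap (@adj G) setT x u = l * x u.
  by rewrite -row_laplacian_mx eig mxE.
split=> [||u _]; last exact: xeig.
  have /eqP := sum_lap setT x (@adj_sym G).
  rewrite (eq_bigr _ (fun u _ => xeig u)) -mulr_sumr mulf_eq0 (negPf l0).
  by move=> /eqP.
have [i vi] := rV0Pn v v0.
by exists (enum_val i); rewrite ?inE // enum_valK.
Qed.

Lemma ex_eigv (l : algC) : l != 0 -> l \in laplacian_spectrum G ->
  exists x, eigv (@adj G) setT l x.
Proof.
move=> l0; rewrite -root_prod_XsubC -spectrumE -eigenvalue_root_char.
case/eigenvalueP=> v eig v0; exists (fun x => v 0 (enum_rank x)).
exact: row_laplacian_eigv.
Qed.

Lemma count_ord_gt1 k (p : pred 'I_k) : (1 < count p (enum 'I_k))%N ->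
  exists i j, [/\ i != j, p i & p j].
Proof.
move: (filter_uniq p (enum_uniq 'I_k)) (mem_filter p ^~ (enum 'I_k)).
rewrite -size_filter; case: filter => [|i [|j s]] //= /andP[+ _] ps _.
rewrite inE negb_or => /andP[ij _]; exists i, j; split=> //.
  by have := ps i; rewrite mem_head => /esym/andP[].
by have := ps j; rewrite !inE eqxx orbT => /esym/andP[].
Qed.

(** An eigenspace of dimension at least 2 meets the hyperplane of vectors vanishing at [w]
    nontrivially. *)
Lemma ex_eigv_vanish (l : algC) (w : G) : l != 0 ->
  (1 < count_mem l (laplacian_spectrum G))%N ->
  exists2 x, eigv (@adj G) setT l x & x w = 0.
Proof.
move=> l0; rewrite (permP (perm_spectrum_diag laplacian_mx_normal)) count_map.
move=> /count_ord_gt1[i [j [ij /eqP/= li /eqP/= lj]]].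
set A := laplacian_mx G in li lj; pose P := spectralmx A.
pose ev a b := a *: row i P + b *: row j P.
have eig a b : ev a b *m A = l *: ev a b.
  rewrite mulmxDl -!scalemxAl !row_spectralmx ?laplacian_mx_normal // li lj.
  by rewrite scalerDr !scalerA ![_ * l]mulrC.
(* These coefficients cancel the entry at [w]; the first case avoids the pair [(0, 0)]. *)
pose ab := if P i (enum_rank w) == 0 then (1, 0) else
  (P j (enum_rank w), - P i (enum_rank w)).
exists (fun x => ev ab.1 ab.2 0 (enum_rank x)).
  apply: row_laplacian_eigv (eig _ _) => //; apply: row_spectralmx_comb_neq0 => //.
  rewrite /ab; case: (eqVneq (P i _)) => [_|nz] /=; first by rewrite oner_eq0.
  by rewrite oppr_eq0 nz orbT.
rewrite /ab !mxE; case: (eqVneq (P i _)) => [->|_] /=.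
  by rewrite mul0r mulr0 addr0.
by rewrite mulrC mulNr subrr.
Qed.

End Spectrum.

(** * The eigenvalues that remain when [j] is at most [n - 3] *)

Theorem theorem4p1 (n i j : nat) (G : sgraph) :
  #|G| = n ->
  0 < i -> i < j -> j <= n ->
  2 \notin [:: i; j] ->
  realizes G (Sset n 2 i j) ->
  1 < i ->
  n < j + 3.
Proof.
move=> cG _ ij jn; rewrite !inE negb_or => /andP[i2 j2] [_ spec] i1.
rewrite ltnNge; apply/negP => jn3.
have [m em] : exists m, n = m.+4 by exists (n - 4); lia.
rewrite {}em in cG jn jn3 spec.
have memS k : k <= m.+4 -> k != i -> k != j -> k \in Sset m.+4 2 i j.
  by rewrite mem_filter mem_cat !mem_iota !inE => *; lia.
have ex k : 0 < k -> k <= m.+4 -> k != i -> k != j ->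
    exists x, eigv (@adj G) setT (k%:R : algC)%R x.
  move=> k0 km ki kj; apply: ex_eigv; first by rewrite pnatr_eq0 -lt0n.
  by rewrite (perm_mem spec) map_f ?memS.
(* Both [i] and [j] lie between 2 and [m.+1], so 1, [m.+2], [m.+3] and [m.+4] are not removed. *)
have [||||xn exn] := ex m.+4; try lia.
have [||||x1 ex1] := ex 1; try lia.
have [||||xn1 exn1] := ex m.+3; try lia.
have [||||xn2 exn2] := ex m.+2; try lia.
apply: (eigenvalues_absurd (@adj_sym G) cG _ exn ex1 exn1 exn2); first lia.
move=> w; apply: ex_eigv_vanish; first by rewrite pnatr_eq0.
rewrite (permP spec) count_map count_filter count_cat.
(* Each of the two blocks of [Sset] contains a 2, and neither copy is removed. *)
pose p k := (k%:R == 2%:R :> algC)%R && (k \notin [:: i; j]).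
have twice (s : seq nat) : 2 \in s -> 0 < count p s.
  move=> s2; rewrite -has_count; apply/hasP; exists 2 => //=.
  by rewrite /p eqxx !inE negb_or i2 j2.
by rewrite (leq_add (twice _ _) (twice _ _)) // mem_iota; lia.
Qed.
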